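(* Let $V$ be a 3-dimensional complex vector space with Hermitian form of signature $(2,1)$, identified with $\mathbb C^3$ carrying the Siegel form $H$. Let $\omega,\omega'\in\partial\mathbb{C}\mathrm{H}^2$, with projective Heisenberg charts $\psi_\omega,\psi_{\omega'}$ built from Hermitian-unitary maps $g_\omega,g_{\omega'}$ (see context). Let $\phi=\psi_{\omega'}\circ\psi_\omega^{-1}$ be the transition map on a nonempty finite overlap (the subset $\psi_\omega(U_\omega\cap U_{\omega'})$ of $\mathbb C\times\mathbb R$), and let $G=g_{\omega'}g_\omega^{-1}$. Then there is a nowhere-zero complex scalar function $\rho$ on the overlap such that $$\widehat\xi(\phi(p))=\rho(p)\,G\,\widehat\xi(p).$$ For the contact form $\theta=\mathrm dt+2\operatorname{Im}(\overline\zeta\,\mathrm d\zeta)$ on $\mathbb C\times\mathbb R$ with coordinates $(\zeta,t)$, $$\phi^*\theta=|\rho|^2\,\theta,\qquad \phi^*(\theta\wedge\mathrm d\theta)=|\rho|^4\,\theta\wedge\mathrm d\theta .$$ Thus all such chart overlaps preserve the contact distribution $\ker\theta$ and transform the contact volume form conformally.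
   Context: Siegel form: $H(Z,W)=Z_0\overline{W_2}+Z_1\overline{W_1}+Z_2\overline{W_0}$ on $\mathbb C^3$. $\partial\mathbb{C}\mathrm{H}^2$ is the set of complex lines $[Z]$ with $Z\neq0$, $H(Z,Z)=0$. A Hermitian-unitary map is an invertible complex-linear map $g$ with $H(gZ,gW)=H(Z,W)$ for all $Z,W$. For $(\zeta,t)\in\mathbb C\times\mathbb R$, $\widehat\xi(\zeta,t)=\left(\frac{-|\zeta|^2+it}{2},\zeta,1\right)$; $\infty=[(1,0,0)]$. For each $\omega\in\partial\mathbb{C}\mathrm{H}^2$ a Hermitian-unitary $g_\omega$ with $g_\omega\omega=\infty$ is chosen, $U_\omega=\partial\mathbb{C}\mathrm{H}^2\setminus\{\omega\}$, and the chart $\psi_\omega:U_\omega\to\mathbb C\times\mathbb R$ is defined by $\psi_\omega([\xi])=(\zeta,t)\iff g_\omega[\xi]=[\widehat\xi(\zeta,t)]$. *)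

(* Defs.v *)
From HB Require Import structures.
From mathcomp Require Import all_boot all_order all_algebra.
From mathcomp Require Import complex.
From mathcomp Require Import all_classical all_reals all_analysis.

Set Implicit Arguments.
Unset Strict Implicit.
Unset Printing Implicit Defensive.

Import Order.TTheory GRing.Theory Num.Theory.
Import numFieldNormedType.Exports.

Local Open Scope classical_set_scope.
Local Open Scope complex_scope.
Local Open Scope ring_scope.

(* [Rcomplex R], the library's alias of [R[i]] that is a module over [R] and is
   normed by the modulus, with the topology of that norm: the complex numbers
   as a real normed space. *)

Lemma Rcomplex_normrZ (R : realType) (l : R) (z : Rcomplex R) :
  `|l *: z| = `|l| * `|z|.
Proof.
rewrite -[LHS]/(Normc.normc _) -[`|z|]/(Normc.normc _).
case: z => a b /=; rewrite !exprMn -mulrDr sqrtrM ?sqr_ge0 //.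
by rewrite sqrtr_sqr.
Qed.

HB.instance Definition _ (R : realType) :=
  PseudoMetric.copy (Rcomplex R) (pseudoMetric_normed (Rcomplex R)).
HB.instance Definition _ (R : realType) := isPointed.Build (Rcomplex R) 0.
HB.instance Definition _ (R : realType) :=
  NormedZmod_PseudoMetric_eq.Build R (Rcomplex R) erefl.
HB.instance Definition _ (R : realType) :=
  PseudoMetricNormedZmod_Lmodule_isNormedModule.Build R (Rcomplex R)
    (@Rcomplex_normrZ R).

Notation C3 R := 'rV[R[i]]_3.

(* The points (zeta, t) of C x R, as a real normed space. *)
Notation heis R := (Rcomplex R * R)%type.

Section SiegelModel.
Variable R : realType.
Implicit Types (Z W : C3 R) (p : heis R) (L w : {vspace C3 R}).

Definition siegel Z W : R[i] :=
  Z 0 0 * (W 0 2)^*%C + Z 0 1 * (W 0 1)^*%C + Z 0 2 * (W 0 0)^*%C.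

Definition boundary : set {vspace C3 R} :=
  [set <[Z]>%VS | Z in [set Z | Z != 0 /\ siegel Z Z = 0]].

Definition row3 (a b c : R[i]) : C3 R := \row_(j < 3) [:: a; b; c]`_j.

Definition infty : {vspace C3 R} := <[(row3 1 0 0)%R]>%VS.

Definition hermitian_unitary (g : 'End(C3 R)) : Prop :=
  lker g = 0%VS /\ forall Z W, siegel (g Z) (g W) = siegel Z W.

Definition xihat p : C3 R :=
  row3 ((- Normc.normc p.1 ^+ 2 +i* p.2) / 2) p.1 1.

Definition chart_dom w : set {vspace C3 R} := boundary `\ w.

(* Only meaningful on [chart_dom w], where [w] is the line that [g] sends to
   [infty]. *)
Definition chart (g : 'End(C3 R)) L : heis R :=
  get [set p | (g @: L)%VS = <[xihat p]>%VS].

Definition chart_inv (g : 'End(C3 R)) w p : {vspace C3 R} :=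
  xget 0%VS [set L | chart_dom w L /\ chart g L = p].

Section ChartFamily.
Variable g : {vspace C3 R} -> 'End(C3 R).

Definition overlap w w' : set (heis R) :=
  chart (g w) @` (chart_dom w `&` chart_dom w').

Definition transition w w' : heis R -> heis R :=
  chart (g w') \o chart_inv (g w) w.

End ChartFamily.
End SiegelModel.

(* Differential forms on a real normed space, as functions of the base point and
   of tangent vectors. *)
Section Forms.
Variables (R : realType) (E : normedModType R).

Definition form1 := E -> E -> R.
Definition form2 := E -> E -> E -> R.
Definition form3 := E -> E -> E -> E -> R.

(* The invariant formula, with u and v extended to constant vector fields, so
   that there is no bracket term. *)
Definition ext_deriv (a : form1) : form2 := fun p u v =>
  'D_u (fun q => a q v) p - 'D_v (fun q => a q u) p.

Definition wedge (a : form1) (b : form2) : form3 := fun p u v w =>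
  a p u * b p v w - a p v * b p u w + a p w * b p u v.

Definition pullback1 (f : E -> E) (a : form1) : form1 := fun p u =>
  a (f p) ('d f p u).

Definition pullback3 (f : E -> E) (c : form3) : form3 := fun p u v w =>
  c (f p) ('d f p u) ('d f p v) ('d f p w).

Definition ker_form (a : form1) (p : E) : set E := [set u | a p u = 0].

End Forms.

Section ContactForm.
Variable R : realType.

(* dt + 2 Im (conj zeta dzeta) *)
Definition theta : form1 (heis R) := fun p u =>
  'd (fun q : heis R => q.2) p u +
  2 * complex.Im ((p.1)^*%C * 'd (fun q : heis R => q.1) p u).

End ContactForm.
Arguments theta {R}.

(* Main.v *)
(** The map xi = xihat lands in the null cone of the Siegel form H, with
    H(dxi(u), xi) = (i/2) theta(u) and dtheta(u, v) = -4 Im H(dxi(u), dxi(v)).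
    On the overlap phi just renormalises the third coordinate of G xi, so that
    xi(phi) = rho G xi with rho the inverse of that coordinate. Differentiating
    (G xi)_2 xi(phi) = G xi by the product rule gives
      dxi(dphi u) = rho G (dxi(u) + s(u) xi)   for some scalar s(u).
    As G preserves H and xi is null, applying H yields phi^* theta =
    |rho|^2 theta, and phi^* dtheta = |rho|^2 (dtheta + (2 Re s) /\ theta),
    whose last term dies after wedging with theta. Finally dphi maps ker theta
    onto ker theta because the reverse transition is a differentiable inverse. *)

Require Import Defs.
From mathcomp Require Import all_boot all_order all_algebra.
From mathcomp Require Import complex.
From mathcomp Require Import all_classical all_reals all_analysis.
From mathcomp Require Import ring lra.

Import Order.TTheory GRing.Theory Num.Theory.
Import numFieldNormedType.Exports.

Local Open Scope classical_set_scope.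
Local Open Scope ring_scope.

Set Implicit Arguments.
Unset Strict Implicit.
Unset Printing Implicit Defensive.

(** * Real differentiability of complex-valued maps *)

Section ComplexCalculus.
Variable R : realType.

Lemma continuous_complexRe : continuous (@complex.Re R : Rcomplex R -> R).
Proof.
apply: bounded_linear_continuous; apply/linear_boundedP.
(* Any bound [r] >= 1 works, because |Re z| <= |z|. *)
near=> r => z; have r1 : 1 <= r by near: r; exact: nbhs_pinfty_ge.
rewrite -[`|z|]/(Normc.normc _); case: z => a b /=.
apply: (@le_trans _ _ (Num.sqrt (a ^+ 2 + b ^+ 2))).
  by rewrite -sqrtr_sqr ler_wsqrtr// lerDl sqr_ge0.
by rewrite ler_peMl ?sqrtr_ge0.
Unshelve. all: by end_near. Qed.

Lemma continuous_complexIm : continuous (@complex.Im R : Rcomplex R -> R).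
Proof.
apply: bounded_linear_continuous; apply/linear_boundedP.
near=> r => z; have r1 : 1 <= r by near: r; exact: nbhs_pinfty_ge.
rewrite -[`|z|]/(Normc.normc _); case: z => a b /=.
apply: (@le_trans _ _ (Num.sqrt (a ^+ 2 + b ^+ 2))).
  by rewrite -sqrtr_sqr ler_wsqrtr// lerDr sqr_ge0.
by rewrite ler_peMl ?sqrtr_ge0.
Unshelve. all: by end_near. Qed.

Lemma complexReD (x y : R[i]) :
  complex.Re (x + y) = complex.Re x + complex.Re y.
Proof. by case: x y => [a b] [c d]. Qed.

Lemma complexImD (x y : R[i]) :
  complex.Im (x + y) = complex.Im x + complex.Im y.
Proof. by case: x y => [a b] [c d]. Qed.

Lemma complexReM (x y : R[i]) : complex.Re (x * y) =
  complex.Re x * complex.Re y - complex.Im x * complex.Im y.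
Proof. by case: x y => [a b] [c d]. Qed.

Lemma complexImM (x y : R[i]) : complex.Im (x * y) =
  complex.Re x * complex.Im y + complex.Im x * complex.Re y.
Proof. by case: x y => [a b] [c d]. Qed.

Lemma is_diff_linear (V W : normedModType R) (f : {linear V -> W}) p :
  continuous f -> is_diff p f f.
Proof.
by move=> cf; apply: DiffDef; [exact: linear_differentiable|exact: diff_lin].
Qed.

Lemma is_diff_unique (V W : normedModType R) (f df dg : V -> W) p :
  is_diff p f df -> is_diff p f dg -> df = dg.
Proof. by move=> [_ <-] [_ <-]. Qed.

(** [g - f] vanishes near [p], hence is o(id) there with differential 0; adding it to [f] leaves the
    differential unchanged. *)
Lemma is_diff_near (V W : normedModType R) (f g df : V -> W) p :
  (\forall q \near p, f q = g q) -> is_diff p f df -> is_diff p g df.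
Proof.
move=> fg fdf; have fgp := nbhs_singleton fg.
have h0 : is_diff p (g - f) 0.
  have H : continuous (0 : V -> W) /\
     (g - f) \o shift p = cst ((g - f) p) + \0 +o_ 0 id.
    split; first exact: cst_continuous.
    apply/eqaddoP => e e0; move: fg; rewrite (near_shift 0) subr0.
    apply: filterS => q /= fgq; rewrite !fctE /=.
    rewrite -[X in `|X|]/(g (q + p) - f (q + p) - (g p - f p + 0)).
    rewrite -fgq fgp !(subrr, addr0, subr0, normr0).
    exact: mulr_ge0 (ltW e0) (normr_ge0 _).
  by split; [apply/diff_locallyP; rewrite (diff_unique H.1 H.2)|
             exact: diff_unique H.1 H.2].
suff -> : g = f + (g - f) by rewrite -[df]addr0; exact: is_diffD.
by rewrite addrC subrK.
Qed.

(* Stated with real and imaginary parts because [R[i]], unlike [Rcomplex R], is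
   not a normed space over [R], and only real-valued products have a product
   rule. *)
Definition is_cdiff (V : normedModType R) (p : V) (f df : V -> R[i]) : Prop :=
  is_diff p (fun q => complex.Re (f q)) (fun u => complex.Re (df u)) /\
  is_diff p (fun q => complex.Im (f q)) (fun u => complex.Im (df u)).

Section Theory.
Variables (V : normedModType R) (p : V).
Implicit Types (f g df dg : V -> R[i]).

Lemma is_cdiff_unique f df dg : is_cdiff p f df -> is_cdiff p f dg -> df =1 dg.
Proof.
move=> [f1 f2] [g1 g2] u; apply/eqP; rewrite eq_complex; apply/andP; split.
  by rewrite [X in _ == X](congr1 (@^~ u) (is_diff_unique g1 f1)).
by rewrite [X in _ == X](congr1 (@^~ u) (is_diff_unique g2 f2)).
Qed.

Lemma is_cdiff_near f g df : (\forall q \near p, f q = g q) ->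
  is_cdiff p f df -> is_cdiff p g df.
Proof.
move=> fg [f1 f2]; split.
  by apply: is_diff_near f1; near=> q; congr complex.Re; near: q.
by apply: is_diff_near f2; near=> q; congr complex.Im; near: q.
Unshelve. all: by end_near. Qed.

Lemma is_cdiff_cst c : is_cdiff p (fun=> c) (fun=> 0).
Proof. by split; exact: is_diff_cst. Qed.

Lemma is_cdiffD f g df dg : is_cdiff p f df -> is_cdiff p g dg ->
  is_cdiff p (fun q => f q + g q) (fun u => df u + dg u).
Proof.
move=> [f1 f2] [g1 g2]; split.
  have := is_diffD f1 g1; congr (is_diff_def _ _ _); apply/funext => q.
    by rewrite /= complexReD.
  by rewrite /= complexReD.
have := is_diffD f2 g2; congr (is_diff_def _ _ _); apply/funext => q.
  by rewrite /= complexImD.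
by rewrite /= complexImD.
Qed.

Lemma is_cdiffM f g df dg : is_cdiff p f df -> is_cdiff p g dg ->
  is_cdiff p (fun q => f q * g q) (fun u => df u * g p + f p * dg u).
Proof.
move=> [f1 f2] [g1 g2]; split.
  have := is_diffB (is_diffM f1 g1) (is_diffM f2 g2).
  congr (is_diff_def _ _ _); apply/funext => q.
    by rewrite /= complexReM.
  rewrite /= complexReD !complexReM.
  rewrite !fctE /GRing.scale /=; ring.
have := is_diffD (is_diffM f1 g2) (is_diffM f2 g1).
congr (is_diff_def _ _ _); apply/funext => q.
  by rewrite /= complexImM.
rewrite /= complexImD !complexImM.
rewrite !fctE /GRing.scale /=; ring.
Qed.

(** The derivative stays existential: [is_diff_transition] uses the differentiability of a
    reciprocal and recovers the derivative it wants from a product rule. *)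
Lemma is_cdiffV f df : is_cdiff p f df -> f p != 0 ->
  exists dg, is_cdiff p (fun q => (f q)^-1) dg.
Proof.
move=> [[f1 _] [f2 _]] fp0.
(* The squared modulus: 1/f has real part Re f / n and imaginary part - Im f / n. *)
pose n q := complex.Re (f q) * complex.Re (f q) +
  complex.Im (f q) * complex.Im (f q).
have n0 : n p != 0.
  apply: contra fp0; rewrite eq_complex /n -!expr2.
  by rewrite paddr_eq0 ?sqr_ge0// !sqrf_eq0.
have dn : differentiable n p.
  by apply: differentiableD; apply: differentiableM.
have dnV := differentiableV dn n0.
have dre := differentiableM f1 dnV.
have dim := differentiableN (differentiableM f2 dnV).
pose re' : V -> R := 'd ((fun q => complex.Re (f q)) * (fun q => (n q)^-1)) p.
pose im' : V -> R :=
  'd (- ((fun q => complex.Im (f q)) * (fun q => (n q)^-1))) p.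
exists (fun u => Complex (re' u) (im' u)).
split => /=.
  have -> : (fun q => complex.Re (f q)^-1) =
      (fun q => complex.Re (f q)) * (fun q => (n q)^-1).
    by apply/funext => q; rewrite !fctE /n; case: (f q).
  exact: differentiableP dre.
have -> : (fun q => complex.Im (f q)^-1) =
    - ((fun q => complex.Im (f q)) * (fun q => (n q)^-1)).
  by apply/funext => q; rewrite !fctE /n; case: (f q).
exact: differentiableP dim.
Qed.

(** Splits [f] over the constant vectors 1 and i, with the real scalars Re f and Im f. *)
Lemma is_diff_Rcomplex f df : is_cdiff p f df ->
  is_diff p (f : V -> Rcomplex R) (df : V -> Rcomplex R).
Proof.
move=> [f1 f2].
have dZ (k dk : V -> R) (z : Rcomplex R) : is_diff p k dk ->
    is_diff p (fun q => k q *: z) (fun u => dk u *: z).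
  by move=> kdk; exact: is_diff_comp kdk (is_diff_scalel _ _).
have := is_diffD (dZ _ _ 1 f1) (dZ _ _ 'i%C f2).
congr (is_diff_def _ _ _); apply/funext => q; rewrite !fctE.
  by case: (f q) => a b; simpc.
by case: (df q) => a b; simpc.
Qed.

Lemma is_cdiff_Rcomplex (f df : V -> Rcomplex R) : is_diff p f df ->
  is_cdiff p f df.
Proof.
move=> fdf; split.
  exact: is_diff_comp fdf (is_diff_linear _ continuous_complexRe).
exact: is_diff_comp fdf (is_diff_linear _ continuous_complexIm).
Qed.

End Theory.

Lemma open_cdiff_neq0 (V : normedModType R) (f : V -> R[i]) :
  (forall p, exists df, is_cdiff p f df) -> open [set q | f q != 0].
Proof.
move=> fP; rewrite openE => p fp; have [df /is_diff_Rcomplex [dfp _]] := fP p.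
exact: (@cvgr_neq0 R (Rcomplex R) _ (nbhs p) (nbhs_filter p) _ _
  (differentiable_continuous dfp) fp).
Qed.

Lemma is_cdiff_comp (V W : normedModType R) (p : V) (h dh : V -> W)
    (f df : W -> R[i]) : is_diff p h dh -> is_cdiff (h p) f df ->
  is_cdiff p (f \o h) (df \o dh).
Proof.
by move=> hdh [f1 f2]; split; [exact: is_diff_comp f1|exact: is_diff_comp f2].
Qed.

(** * Real differentiation of maps into C^3 *)

Definition is_vdiff (V : normedModType R) (p : V) (F dF : V -> C3 R) : Prop :=
  forall j, is_cdiff p (fun q => F q 0 j) (fun u => dF u 0 j).

Lemma is_vdiff_unique (V : normedModType R) (p : V) (F dF dG : V -> C3 R) :
  is_vdiff p F dF -> is_vdiff p F dG -> dF =1 dG.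
Proof.
move=> h1 h2 u; apply/rowP => j.
exact: is_cdiff_unique (h1 j) (h2 j) u.
Qed.

Lemma is_vdiff_near (V : normedModType R) (p : V) (F G dF : V -> C3 R) :
  (\forall q \near p, F q = G q) -> is_vdiff p F dF -> is_vdiff p G dF.
Proof.
move=> FG FdF j; apply: is_cdiff_near (FdF j).
by near=> q; congr (fun_of_matrix _ 0 j); near: q.
Unshelve. all: by end_near. Qed.

Lemma is_vdiff_comp (V W : normedModType R) (p : V) (h dh : V -> W)
    (F dF : W -> C3 R) : is_diff p h dh -> is_vdiff (h p) F dF ->
  is_vdiff p (F \o h) (dF \o dh).
Proof. by move=> hdh FdF j; exact: is_cdiff_comp hdh (FdF j). Qed.

Lemma is_vdiffZ (V : normedModType R) (p : V) (f df : V -> R[i])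
    (F dF : V -> C3 R) : is_cdiff p f df -> is_vdiff p F dF ->
  is_vdiff p (fun q => f q *: F q) (fun u => df u *: F p + f p *: dF u).
Proof.
move=> fdf FdF j; have := is_cdiffM fdf (FdF j).
by congr (is_cdiff _ _ _); apply/funext => q; rewrite !mxE.
Qed.

Lemma is_vdiff_lfun (V : normedModType R) (p : V) (G : 'End(C3 R))
    (F dF : V -> C3 R) : is_vdiff p F dF ->
  is_vdiff p (fun q => G (F q)) (fun u => G (dF u)).
Proof.
move=> FdF j.
(* By complex linearity, entry [j] of [G Z] combines the coordinates of [Z] with constant
   coefficients, so the sum and product rules suffice. *)
have Gj Z : (G Z) 0 j = Z 0 0 * (G (delta_mx 0 0)) 0 j +
    Z 0 1 * (G (delta_mx 0 1)) 0 j + Z 0 2 * (G (delta_mx 0 2)) 0 j.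
  rewrite {1}(row_sum_delta Z) linear_sum summxE !big_ord_recl big_ord0 addr0.
  rewrite !linearZ !mxE addrA.
  have -> : lift ord0 (lift ord0 ord0) = 2 :> 'I_3 by exact: val_inj.
  have -> : lift ord0 ord0 = 1 :> 'I_3 by exact: val_inj.
  by [].
have dFc k c : is_cdiff p (fun q => F q 0 k * c) (fun u => dF u 0 k * c).
  suff -> : (fun u => dF u 0 k * c) = (fun u => dF u 0 k * c + F p 0 k * 0).
    exact: is_cdiffM (FdF k) (is_cdiff_cst p c).
  by apply/funext => u; rewrite mulr0 addr0.
have dG H : (forall Z, (G Z) 0 j = H Z) ->
    is_cdiff p (fun q => H (F q)) (fun u => H (dF u)) ->
    is_cdiff p (fun q => (G (F q)) 0 j) (fun u => (G (dF u)) 0 j).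
  by move=> GH; congr (is_cdiff _ _ _); apply/funext => q; rewrite GH.
apply: (dG _ Gj).
exact: is_cdiffD (is_cdiffD (dFc 0 _) (dFc 1 _)) (dFc 2 _).
Qed.

End ComplexCalculus.

(** * The Siegel form along xihat *)

Section SiegelAlgebra.
Variable R : realType.
Implicit Types (p q u v : heis R) (Z W : C3 R) (z : R[i]).

Lemma rV3P Z W : Z 0 0 = W 0 0 -> Z 0 1 = W 0 1 -> Z 0 2 = W 0 2 -> Z = W.
Proof.
move=> h0 h1 h2; apply/rowP => -[[|[|[|//]]] h] /=.
- by have -> : Ordinal h = 0 by exact: val_inj.
- by have -> : Ordinal h = 1 by exact: val_inj.
- by have -> : Ordinal h = 2 by exact: val_inj.
Qed.

Lemma row3E (a b c : R[i]) :
  ((row3 a b c 0 0 = a) * (row3 a b c 0 1 = b) * (row3 a b c 0 2 = c))%type.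
Proof. by rewrite !mxE. Qed.

Lemma siegelDl Z1 Z2 W : siegel (Z1 + Z2) W = siegel Z1 W + siegel Z2 W.
Proof. rewrite /siegel !mxE; ring. Qed.

Lemma siegelZl z Z W : siegel (z *: Z) W = z * siegel Z W.
Proof. rewrite /siegel !mxE; ring. Qed.

Lemma siegel_conj Z W : siegel W Z = (siegel Z W)^*%C.
Proof. rewrite /siegel !rmorphD !rmorphM /= !conjcK; ring. Qed.

Lemma siegelDr Z W1 W2 : siegel Z (W1 + W2) = siegel Z W1 + siegel Z W2.
Proof. by rewrite siegel_conj siegelDl rmorphD /= -!siegel_conj. Qed.

Lemma siegelZr z Z W : siegel Z (z *: W) = z^*%C * siegel Z W.
Proof. by rewrite siegel_conj siegelZl rmorphM /= -siegel_conj. Qed.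

Lemma sqr_normc_Re_Im z :
  Normc.normc z ^+ 2 = complex.Re z ^+ 2 + complex.Im z ^+ 2.
Proof. by case: z => a b; rewrite sqr_sqrtr// addr_ge0 ?sqr_ge0. Qed.

Lemma mul_conjc z : z * z^*%C = ((Normc.normc z ^+ 2)%:C)%C.
Proof.
rewrite sqr_normc_Re_Im; case: z => a b /=; apply/eqP.
by rewrite eq_complex /=; apply/andP; split; apply/eqP; ring.
Qed.

Lemma complex_div2 (a b : R) : ((a +i* b)%C / 2 : R[i]) = (a / 2 +i* (b / 2))%C.
Proof.
have n2 : (2 : R[i]) != 0 by rewrite pnatr_eq0.
apply: (mulIf n2); rewrite divfK// mulr_natr mulr2n; apply/eqP.
by rewrite eq_complex /=; apply/andP; split; apply/eqP; field.
Qed.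

(** The differential of [xihat]; its first entry uses d|zeta|^2 = 2 Re(conj zeta dzeta). *)
Definition dxihat p u : C3 R :=
  row3 ((- (2 * complex.Re (p.1^*%C * u.1)) / 2) +i* (u.2 / 2))%C u.1 0.

(** With third coordinate 1, H(Z, Z) = 2 Re Z_0 + |Z_1|^2, and Re Z_0 = -|zeta|^2/2 cancels it. *)
Lemma siegel_xihat p : siegel (xihat p) (xihat p) = 0.
Proof.
rewrite /siegel /xihat !row3E sqr_normc_Re_Im; case: p => -[a b] t /=.
rewrite complex_div2; apply/eqP.
by rewrite eq_complex /=; apply/andP; split; apply/eqP; field.
Qed.

Lemma is_diff_fst p : is_diff p (fun q : heis R => q.1) (fun u => u.1).
Proof.
exact: (@is_diff_linear R (heis R) (Rcomplex R) fst p (fun x => cvg_fst)).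
Qed.

Lemma is_diff_snd p : is_diff p (fun q : heis R => q.2) (fun u => u.2).
Proof.
exact: (@is_diff_linear R (heis R) R snd p (fun x => cvg_snd)).
Qed.

Lemma thetaE p u : theta p u = u.2 + 2 * complex.Im (p.1^*%C * u.1).
Proof.
by rewrite /theta (@diff_val _ _ _ _ _ _ _ (is_diff_fst p))
  (@diff_val _ _ _ _ _ _ _ (is_diff_snd p)).
Qed.

(** The real part vanishes, as differentiating H(xi, xi) = 0 predicts; the imaginary part expresses
    theta through H, which makes it accessible to isometries. *)
Lemma siegel_dxihat p u :
  siegel (dxihat p u) (xihat p) = (0 +i* (theta p u / 2))%C.
Proof.
rewrite thetaE /siegel /xihat /dxihat !row3E complex_div2.
case: p u => -[a b] t [[c d] s] /=; apply/eqP.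
by rewrite eq_complex /=; apply/andP; split; apply/eqP; field.
Qed.

Lemma is_vdiff_xihat p : is_vdiff p (@xihat R) (dxihat p).
Proof.
have [fr fi] := is_cdiff_Rcomplex (is_diff_fst p).
move=> j; have : j \in [:: 0; 1; 2 : 'I_3].
  by rewrite !inE; case: j => [[|[|[|//]]] h].
rewrite !inE => /or3P[] /eqP ->; last 2 first.
- apply: is_cdiff_Rcomplex.
  have := is_diff_fst p; congr (is_diff_def _ _ _);
  by apply/funext => q; rewrite row3E.
- have := is_cdiff_cst p (1 : R[i]); congr (is_cdiff _ _ _);
  by apply/funext => q; rewrite row3E.
split.
  have := is_diffZ (- 2^-1) (is_diffD (is_diffM fr fr) (is_diffM fi fi)).
  congr (is_diff_def _ _ _); apply/funext => q; rewrite row3E ?complex_div2 /=.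
    by rewrite sqr_normc_Re_Im /= !fctE /GRing.scale /=; field.
  case: q p {fr fi} => -[a b] t [[c d] s].
  by rewrite /= !fctE /GRing.scale /=; field.
have := is_diffZ 2^-1 (is_diff_snd p).
congr (is_diff_def _ _ _); apply/funext => q; rewrite row3E ?complex_div2 /=.
  by rewrite !fctE /GRing.scale /= mulrC.
by rewrite !fctE /GRing.scale /= mulrC.
Qed.

(** The base point enters theta only through conj zeta, and linearly; antisymmetry of Im(conj u v)
    then doubles the coefficient 2. *)
Lemma ext_deriv_theta p u v :
  ext_deriv theta p u v = 4 * complex.Im (u.1^*%C * v.1).
Proof.
have D x y : 'D_x (fun q => theta q y) p = 2 * complex.Im (x.1^*%C * y.1).
  have [fr fi] := is_cdiff_Rcomplex (is_diff_fst p).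
  have h : is_diff p (fun q => theta q y)
      (fun x => 2 * complex.Im (x.1^*%C * y.1)).
    have hc : is_diff p (fun=> y.2) (fun=> 0 : R) by exact: is_diff_cst.
    have := is_diffD hc (is_diffZ 2 (is_diffB
      (is_diffZ (complex.Im y.1) fr) (is_diffZ (complex.Re y.1) fi))).
    congr (is_diff_def _ _ _); apply/funext => q.
      rewrite thetaE !fctE /GRing.scale /=.
      case: q => -[a b] t /=; case: y {hc} => -[c d] s /=; ring.
    rewrite !fctE /GRing.scale /=.
    case: q => -[a b] t /=; case: y {hc} => -[c d] s /=; ring.
  by rewrite deriveE ?(@diff_val _ _ _ _ _ _ _ h)//; case: h.
rewrite /ext_deriv !D.
case: u => -[a b] t /=; case: v => -[c d] s /=; ring.
Qed.

(** Both third entries are 0, so H reduces to u_1 conj(v_1); the sign comes from moving the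
    conjugation to the other factor. *)
Lemma ext_deriv_theta_siegel p u v :
  ext_deriv theta p u v = - 4 * complex.Im (siegel (dxihat p u) (dxihat p v)).
Proof.
rewrite ext_deriv_theta /siegel /dxihat !row3E.
by case: u => -[a b] t /=; case: v => -[c d] s /=; ring.
Qed.

(** * Pullback of theta and its exterior derivative under a rescaled isometry *)

Section Transform.
Variables (G : 'End(C3 R)) (p p' : heis R) (rho : R[i]).
Variables (s : heis R -> R[i]) (d : heis R -> heis R).
Hypothesis Gherm : forall Z W, siegel (G Z) (G W) = siegel Z W.
Hypothesis xihat_p' : xihat p' = rho *: G (xihat p).
Hypothesis dxihat_p' :
  forall u, dxihat p' (d u) = rho *: G (dxihat p u + s u *: xihat p).

Lemma theta_transform u : theta p' (d u) = Normc.normc rho ^+ 2 * theta p u.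
Proof.
have := siegel_dxihat p' (d u).
rewrite dxihat_p' xihat_p' siegelZl siegelZr mulrA mul_conjc Gherm siegelDl.
rewrite siegelZl siegel_xihat mulr0 addr0 siegel_dxihat.
move=> /(congr1 (@complex.Im R)) ; rewrite complexImM /= mul0r addr0 => h.
apply: (mulIf (_ : 2^-1 != 0 :> R)); first by rewrite invr_eq0 pnatr_eq0.
by rewrite -h mulrA.
Qed.

Lemma ext_deriv_theta_transform u v : ext_deriv theta p' (d u) (d v) =
  Normc.normc rho ^+ 2 * (ext_deriv theta p u v +
    2 * (complex.Re (s u) * theta p v - complex.Re (s v) * theta p u)).
Proof.
rewrite !ext_deriv_theta_siegel !dxihat_p' siegelZl siegelZr mulrA mul_conjc.
rewrite Gherm !(siegelDl, siegelDr, siegelZl, siegelZr) siegel_xihat.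
rewrite (siegel_conj (dxihat p v) (xihat p)) !siegel_dxihat.
(* The s(u) conj(s(v)) term has died by nullity; the two mixed terms pair [dxihat] with [xihat],
   which is purely imaginary, so only Re s survives in the imaginary part. *)
case: (siegel _ _) => x y; case: (s u) => a b; case: (s v) => c e.
by rewrite /=; field.
Qed.

Lemma wedge_transform u v x :
  wedge theta (ext_deriv theta) p' (d u) (d v) (d x) =
  Normc.normc rho ^+ 4 * wedge theta (ext_deriv theta) p u v x.
Proof.
rewrite /wedge !theta_transform !ext_deriv_theta_transform.
(* With all values turned into variables, the cancellation of theta /\ Re s /\ theta is a polynomial
   identity. *)
move: (Normc.normc rho) (theta p u) (theta p v) (theta p x) => n tu tv tx.
move: (ext_deriv theta p u v) (ext_deriv theta p u x) => euv eux.
move: (ext_deriv theta p v x) (complex.Re (s u)) => evx su.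
by move: (complex.Re (s v)) (complex.Re (s x)) => sv sx; ring.
Qed.

End Transform.
End SiegelAlgebra.

(** * Heisenberg charts *)

Section Charts.
Variable R : realType.
Implicit Types (p q u v : heis R) (Z W : C3 R) (L : {vspace C3 R}).

(** Heisenberg coordinates of the null line spanned by [Z], read off after scaling the third
    coordinate to 1. *)
Definition heis_of Z : heis R :=
  (Z 0 1 / Z 0 2, 2 * complex.Im (Z 0 0 / Z 0 2)).

Lemma heis_of_xihat p : heis_of (xihat p) = p.
Proof.
case: p => -[a b] t; rewrite /heis_of !row3E !divr1 complex_div2 /=.
by congr pair; field.
Qed.

Lemma heis_ofZ z Z : z != 0 -> heis_of (z *: Z) = heis_of Z.
Proof.
move=> z0; have zK (a b : R[i]) : (z * a) / (z * b) = a / b.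
  by rewrite -mulf_div divff// mul1r.
have zZ j : (z *: Z) 0 j = z * Z 0 j by rewrite mxE.
by rewrite /heis_of !zZ !zK.
Qed.

(** [heis_of] forgets only the real part of the normalised first coordinate, and nullity forces it
    to be -|zeta|^2/2. *)
Lemma xihat_heis_of Z : siegel Z Z = 0 -> Z 0 2 != 0 ->
  xihat (heis_of Z) = (Z 0 2)^-1 *: Z.
Proof.
move=> Z0 Z2; apply: rV3P; rewrite row3E !mxE.
- have : siegel ((Z 0 2)^-1 *: Z) ((Z 0 2)^-1 *: Z) = 0.
    by rewrite siegelZl siegelZr Z0 !mulr0.
  rewrite /siegel !mxE mulVf// conjc1 mulr1 mul1r /heis_of sqr_normc_Re_Im /=.
  rewrite ![(Z 0 2)^-1 * _]mulrC complex_div2.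
  case: (Z 0 0 / _) (Z 0 1 / _) => [a b] [c d] /= /eqP.
  rewrite eq_complex /= => /andP[/eqP h _].
  apply/eqP; rewrite eq_complex /=; apply/andP; split; apply/eqP; last by field.
  by lra.
- by rewrite /= mulrC.
- by rewrite mulVf.
Qed.

Lemma vlineE Z W : <[Z]>%VS = <[W]>%VS -> exists z, Z = z *: W.
Proof. by move=> ZW; apply/vlineP; rewrite -ZW memv_line. Qed.

Lemma vlineZ z Z : z != 0 -> <[z *: Z]>%VS = <[Z]>%VS.
Proof.
move=> z0; apply/eqP; rewrite eqEsubv -!memvE memvZ ?memv_line//=.
by rewrite -[Z in Z \in _](scalerK z0) memvZ ?memv_line.
Qed.

Lemma xihat_neq0 p : xihat p != 0.
Proof.
apply/eqP => /rowP/(_ 2); rewrite row3E mxE => /eqP.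
by rewrite oner_eq0.
Qed.

Lemma xihat_line_inj p q : <[xihat p]>%VS = <[xihat q]>%VS -> p = q.
Proof.
move=> /vlineE[z pz]; rewrite -(heis_of_xihat p) pz heis_ofZ ?heis_of_xihat//.
by apply: contra_eq_neq pz => ->; rewrite scale0r xihat_neq0.
Qed.

Lemma line_heis_of Z : siegel Z Z = 0 -> Z 0 2 != 0 ->
  <[xihat (heis_of Z)]>%VS = <[Z]>%VS.
Proof. by move=> Z0 Z2; rewrite xihat_heis_of// vlineZ// invr_eq0. Qed.

(** When Z_2 = 0 the form is |Z_1|^2, so nullity leaves only the first coordinate. *)
Lemma line_eq_infty Z : Z != 0 -> siegel Z Z = 0 ->
  (<[Z]>%VS == infty R) = (Z 0 2 == 0).
Proof.
move=> Z0 ZZ; apply/eqP/eqP => [/vlineE[z ->]|Z2].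
  by rewrite mxE row3E mulr0.
move: ZZ; rewrite /siegel Z2 conjc0 mulr0 mul0r addr0 add0r mul_conjc.
move=> /(congr1 (@complex.Re R)) /= /eqP; rewrite expf_eq0 /= => /eqP.
move=> /Normc.eq0_normc Z1.
have ZE : Z = Z 0 0 *: row3 1 0 0.
  by apply: rV3P; rewrite !mxE ?row3E ?mulr1 ?mulr0.
rewrite ZE vlineZ//; apply: contra Z0 => /eqP Z00.
by rewrite ZE Z00 scale0r.
Qed.

Section Chart.
Variables (g : 'End(C3 R)) (w : {vspace C3 R}).
Hypotheses (hg : hermitian_unitary g) (gw : (g @: w)%VS = infty R).

Lemma lker_chart : lker g == 0%VS.
Proof. by rewrite hg.1. Qed.

(** Distinct points have distinct lines under [xihat], so the choice made by [get] is forced. *)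
Lemma chart_eq_of_line L p : (g @: L)%VS = <[xihat p]>%VS -> chart g L = p.
Proof.
move=> gL; apply: get_unique => // q /=; rewrite gL => h.
exact/esym/xihat_line_inj.
Qed.

Lemma unitary_neq0 Z : Z != 0 -> g Z != 0.
Proof.
apply: contra => /eqP gZ.
by rewrite -(lker0_lfunK lker_chart Z) gZ linear0.
Qed.

(** [g] is injective on subspaces and sends [w] to infinity, so avoiding [w] means that the image
    avoids infinity. *)
Lemma chart_dom_line Z : Z != 0 -> siegel Z Z = 0 ->
  chart_dom w <[Z]>%VS <-> g Z 0 2 != 0.
Proof.
move=> Z0 ZZ.
rewrite -line_eq_infty ?unitary_neq0 ?hg.2// -gw -limg_line.
rewrite eq_limg_ker0 ?lker_chart//.
split=> [[_ /eqP//]|/eqP h]; split=> //=.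
by exists Z.
Qed.

Lemma chart_line Z : g Z 0 2 != 0 -> siegel Z Z = 0 ->
  chart g <[Z]>%VS = heis_of (g Z).
Proof.
move=> gZ2 ZZ; apply: chart_eq_of_line.
by rewrite limg_line line_heis_of ?hg.2.
Qed.

Lemma unitary_invK Z : g ((g^-1)%VF Z) = Z.
Proof. by rewrite lker0_lfunVK ?lker_chart. Qed.

(** A null vector spanning the boundary line with chart value [p]. *)
Definition lift_xihat p : C3 R := (g^-1)%VF (xihat p).

Lemma lift_xihat_neq0 p : lift_xihat p != 0.
Proof.
apply/eqP => h; have := xihat_neq0 p.
by rewrite -(unitary_invK (xihat p)) -/(lift_xihat p) h linear0 eqxx.
Qed.

Lemma siegel_lift_xihat p : siegel (lift_xihat p) (lift_xihat p) = 0.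
Proof. by rewrite -hg.2 unitary_invK siegel_xihat. Qed.

Lemma chart_dom_lift_xihat p : chart_dom w <[lift_xihat p]>%VS.
Proof.
apply/chart_dom_line; rewrite ?lift_xihat_neq0 ?siegel_lift_xihat//.
by rewrite unitary_invK row3E oner_eq0.
Qed.

Lemma chart_lift_xihat p : chart g <[lift_xihat p]>%VS = p.
Proof. by apply: chart_eq_of_line; rewrite limg_line unitary_invK. Qed.

Lemma chart_inj L p : chart_dom w L -> chart g L = p -> L = <[lift_xihat p]>%VS.
Proof.
move=> domL; have [[Z [Z0 ZZ] ZL] _] := domL.
move: domL; rewrite -ZL => /(chart_dom_line Z0 ZZ) gZ2.
rewrite chart_line// => <-.
by apply/eqP; rewrite -(eq_limg_ker0 _ _ lker_chart) !limg_line unitary_invK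
  line_heis_of ?hg.2.
Qed.

(** Exactly one line of the domain has chart value [p], so [xget] never returns its default 0. *)
Lemma chart_invE p : chart_inv g w p = <[lift_xihat p]>%VS.
Proof.
apply: xget_unique => [|L [domL]]; last exact: chart_inj.
by split; [exact: chart_dom_lift_xihat|exact: chart_lift_xihat].
Qed.

End Chart.
End Charts.

(** * Transition maps *)

Section Transition.
Variable R : realType.
Implicit Types (p q u v : heis R).

Section Pair.
Variables (g g' : 'End(C3 R)) (w w' : {vspace C3 R}).
Hypotheses (hg : hermitian_unitary g) (gw : (g @: w)%VS = infty R).
Hypotheses (hg' : hermitian_unitary g') (gw' : (g' @: w')%VS = infty R).

(** [overlap] and [transition] for one pair of isometries, so that exchanging the pair yields every
    result for the reverse transition. *)
Let O : set (heis R) := chart g @` (chart_dom w `&` chart_dom w').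
Let phi : heis R -> heis R := chart g' \o chart_inv g w.
Let G : 'End(C3 R) := (g' \o g^-1)%VF.

Lemma siegel_trans Z W : siegel (G Z) (G W) = siegel Z W.
Proof. by rewrite !comp_lfunE hg'.2 -hg.2 !(unitary_invK hg). Qed.

(** The line over [p] always avoids [w]; it avoids [w'] exactly when its image under [g'] has
    nonzero third coordinate. *)
Lemma overlapE p : O p <-> G (xihat p) 0 2 != 0.
Proof.
rewrite comp_lfunE -[_ (xihat p)]/(lift_xihat g p).
split=> [[L [domL dom'L] gL]|Gp].
  move: dom'L; rewrite (chart_inj hg gw domL gL).
  by move/(chart_dom_line hg' gw' (lift_xihat_neq0 hg p)
    (siegel_lift_xihat hg p)).
exists <[lift_xihat g p]>%VS; last exact: chart_lift_xihat.
split; first exact: chart_dom_lift_xihat.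
exact/(chart_dom_line hg' gw' (lift_xihat_neq0 hg p) (siegel_lift_xihat hg p)).
Qed.

Lemma transitionE p : O p -> phi p = heis_of (G (xihat p)).
Proof.
move=> /overlapE Gp; rewrite /phi /= (chart_invE hg gw) /G comp_lfunE.
by rewrite chart_line ?siegel_lift_xihat//; move: Gp; rewrite comp_lfunE.
Qed.

(** [G (xihat p)] is again null, so dividing by its third coordinate puts it in the form [xihat];
    this identifies rho. *)
Lemma xihat_transition p : O p ->
  xihat (phi p) = (G (xihat p) 0 2)^-1 *: G (xihat p).
Proof.
move=> Op; rewrite transitionE// xihat_heis_of ?siegel_trans ?siegel_xihat//.
exact/overlapE.
Qed.

Lemma is_vdiff_trans p :
  is_vdiff p (fun q => G (xihat q)) (fun u => G (dxihat p u)).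
Proof. exact/is_vdiff_lfun/is_vdiff_xihat. Qed.

Lemma open_overlap : open O.
Proof.
have -> : O = [set q | G (xihat q) 0 2 != 0].
  by apply/seteqP; split=> q /overlapE.
apply: (@open_cdiff_neq0 R (heis R)) => p; eexists.
exact: is_vdiff_trans p 2.
Qed.

Lemma is_diff_transition p : O p -> exists d s, is_diff p phi d /\
  forall u, dxihat (phi p) (d u) =
    (G (xihat p) 0 2)^-1 *: G (dxihat p u + s u *: xihat p).
Proof.
move=> Op; have Gp := (overlapE p).1 Op; set c := G (xihat p) 0 2.
have dG := is_vdiff_trans p.
have [dcV hcV] := is_cdiffV (dG 2) Gp.
have [fr fi] := is_cdiffM (dG 0) hcV.
(* Differentiates [heis_of (G (xihat q))], whose coordinates are quotients by the third entry. *)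
have := is_diff_pair (is_diff_Rcomplex (is_cdiffM (dG 1) hcV)) (is_diffZ 2 fi).
set d := (X in is_diff _ _ X) => dh.
(* The quotient formula describes [phi] only on the overlap; openness makes it valid near [p]. *)
have near_ov : \forall q \near p, O q.
  by apply: open_nbhs_nbhs; split=> //; exact: open_overlap.
have dphi : is_diff p phi d.
  apply: is_diff_near dh; near=> q; rewrite transitionE//.
  by near: q.
(* This s is the logarithmic derivative -dc/c of rho = 1/c. *)
exists d, (fun u => - (c^-1 * G (dxihat p u) 0 2)); split=> // u.
(* [d1] and [d2] differentiate the same function, by the product rule and through its equality with
   G xi near [p]; uniqueness equates the results. *)
have d1 := is_vdiffZ (dG 2) (is_vdiff_comp dphi (is_vdiff_xihat (phi p))).
have d2 : is_vdiff p (fun q => G (xihat q) 0 2 *: xihat (phi q))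
    (fun u => G (dxihat p u)).
  apply: is_vdiff_near dG; near=> q.
  have Oq : O q by near: q.
  by rewrite xihat_transition// scalerA divff ?scale1r//; exact/overlapE.
have := is_vdiff_unique d1 d2 u; rewrite /= -/c.
rewrite linearD linearZ /=; set k := G (dxihat p u) 0 2 => <-.
have -> : G (xihat p) = c *: xihat (phi p).
  by rewrite xihat_transition// scalerA divff ?scale1r.
rewrite addrAC !scalerA -scalerDl.
have -> : k + - (c^-1 * k) * c = 0 by field.
by rewrite scale0r add0r scalerA mulVf ?scale1r.
Unshelve. all: by end_near. Qed.

(** Both transitions pass through the same boundary line, which lies in both chart domains. *)
Lemma transitionK p : O p ->
  (chart g' @` (chart_dom w' `&` chart_dom w)) (phi p) /\
  (chart g \o chart_inv g' w') (phi p) = p.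
Proof.
move=> /overlapE; rewrite comp_lfunE -[_ (xihat p)]/(lift_xihat g p).
move=> /(chart_dom_line hg' gw' (lift_xihat_neq0 hg p)
  (siegel_lift_xihat hg p)).
rewrite /phi /= (chart_invE hg gw); set L := <[_]>%VS => dom'L.
split.
  by exists L => //; split=> //; exact: chart_dom_lift_xihat.
rewrite (chart_invE hg' gw') -(chart_inj hg' gw' dom'L erefl).
exact: chart_lift_xihat.
Qed.

End Pair.
End Transition.

Unset Implicit Arguments.

Theorem theorem17p4 (R : realType) (g : {vspace C3 R} -> 'End(C3 R))
    (hg : forall v, boundary v ->
       hermitian_unitary (g v) /\ (g v @: v)%VS = infty R)
    (w w' : {vspace C3 R}) (hw : boundary w) (hw' : boundary w')
    (hne : overlap g w w' !=set0) :
  let O := overlap g w w' in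
  let phi := transition g w w' in
  let G : 'End(C3 R) := (g w' \o (g w)^-1)%VF in
  open O /\ (forall p, O p -> differentiable phi p) /\
  exists rho : heis R -> R[i],
    [/\ forall p, O p -> rho p != 0,
        forall p, O p -> xihat (phi p) = rho p *: G (xihat p),
        forall p, O p -> forall u : heis R,
          pullback1 phi theta p u = Normc.normc (rho p) ^+ 2 * theta p u,
        forall p, O p -> forall u v x : heis R,
          pullback3 phi (wedge theta (ext_deriv theta)) p u v x =
          Normc.normc (rho p) ^+ 4 * wedge theta (ext_deriv theta) p u v x
      & forall p, O p -> 'd phi p @` ker_form theta p = ker_form theta (phi p)].
Proof.
move=> O phi G.
have [hu hw2] := hg _ hw; have [hu' hw2'] := hg _ hw'.
pose rho p := (G (xihat p) 0 2)^-1.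
have OG p : O p -> G (xihat p) 0 2 != 0 by move/(overlapE hu hw2 hu' hw2').
have dphiP p : O p -> exists d s, is_diff p phi d /\
    forall u, dxihat (phi p) (d u) = rho p *: G (dxihat p u + s u *: xihat p).
  by move=> Op; exact: (is_diff_transition hu hw2 hu' hw2' Op).
have xiP p : O p -> xihat (phi p) = rho p *: G (xihat p).
  by move=> Op; exact: (xihat_transition hu hw2 hu' hw2' Op).
have Gu := siegel_trans hu hu'.
have thetaP p : O p -> forall u,
    pullback1 phi theta p u = Normc.normc (rho p) ^+ 2 * theta p u.
  move=> Op u; have [d [s [dphi ds]]] := dphiP p Op.
  have dE := @diff_val _ _ _ _ _ _ _ dphi.
  by rewrite /pullback1 dE; exact: theta_transform Gu (xiP p Op) ds u.
split; first exact: (open_overlap hu hw2 hu' hw2').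
split; first by move=> p Op; have [d [s [[]]]] := dphiP p Op.
exists rho; split=> // [p Op|p Op u v x|p Op].
- by rewrite invr_eq0 OG.
- have [d [s [dphi ds]]] := dphiP p Op.
  have dE := @diff_val _ _ _ _ _ _ _ dphi.
  by rewrite /pullback3 dE; exact: wedge_transform Gu (xiP p Op) ds u v x.
apply/seteqP; split=> [_ [u /= tu <-]|y ty].
  by have := thetaP p Op u; rewrite /pullback1 /ker_form /= tu mulr0.
have [ovq phi'q] := transitionK hu hw2 hu' hw2' Op.
have [d [s [dphi _]]] := dphiP p Op.
have [d' [s' [dphi' ds']]] := is_diff_transition hu' hw2' hu hw2 ovq.
have xiq := xihat_transition hu' hw2' hu hw2 ovq.
have Gu' := siegel_trans hu' hu.
(* The preimage of [y] is its image under the differential of the reverse transition, which lies in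
   ker theta by the same transformation law. *)
exists (d' y) => /=.
  have := theta_transform Gu' xiq ds' y.
  by rewrite phi'q ty mulr0.
(* Rewrites the base point [p] as the reverse transition of [phi p], as the chain rule expects. *)
have dphi'' := dphi; rewrite -phi'q in dphi''.
have h1 := is_diff_comp dphi' dphi''.
have near_ov : \forall q \near (phi p), overlap g w' w q.
  by apply: open_nbhs_nbhs; split=> //; exact: (open_overlap hu' hw2' hu hw2).
(* The composite is the identity on the open reverse overlap, so uniqueness of the differential
   gives [d (d' y) = y]. *)
have h2 : is_diff (phi p) (phi \o transition g w' w) id.
  apply: is_diff_near (is_diff_id _); near=> q.
  have ovr : overlap g w' w q by near: q.
  by have [_ phiK] := transitionK hu' hw2' hu hw2 ovr; exact: esym phiK.
by rewrite (@diff_val _ _ _ _ _ _ _ dphi)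
  -[RHS](congr1 (@^~ y) (is_diff_unique h1 h2)).
Unshelve. all: by end_near. Qed.
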